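(* Let $N\ge 2$, let $\lambda>0$ be a fixed constant, and let $F(q,m)=[F_1(q,m),\dots,F_N(q,m)]^T\in\mathbb{R}^{2N}$ be given by $$F_i(q,m)=\sum_{j=1,\,j\ne i}^{N}\frac{m_im_j(q_j-q_i)}{\|q_i-q_j\|^3}+\lambda m_iq_i,\qquad i=1,\dots,N .$$ Let $q_0$ be a central configuration for the mass vector $m_0$ in the sense that $F(q_0,m_0)=0$. Let $$P=\begin{bmatrix} B_1 & 0\\ B_2 & I\end{bmatrix}\in\mathbb{R}^{2N\times 2N},\qquad \begin{bmatrix} B_1\\ B_2\end{bmatrix}=A'(0)q_0 ,$$ where $B_1$ is $1\times 1$, $B_2$ is $(2N-1)\times 1$, $I$ is the $(2N-1)\times(2N-1)$ identity matrix, and suppose that $P$ is invertible. Then $$P^{-1}\,\mathrm{Jac}(F)|_{(q_0,m_0)}\,P=\begin{bmatrix} 0 & J_1\\ 0 & J_2\end{bmatrix}$$ with $J_2$ a $(2N-1)\times(2N-1)$ matrix.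
   Context: Masses $m=(m_1,\dots,m_N)$ are positive. Positions are $q=(q_1,\dots,q_N)\in\mathbb{R}^{2N}$ with $q_i=(x_i,y_i)^T\in\mathbb{R}^2$, written as a column $(x_1,y_1,\dots,x_N,y_N)^T$, and configurations are collision-free ($q_i\neq q_j$ for $i\ne j$). $\|\cdot\|$ is the Euclidean norm. $\mathrm{Jac}(F)|_{(q_0,m_0)}$ is the $2N\times 2N$ Jacobian matrix of $F$ with respect to $q$ (the masses and $\lambda$ being held constant), evaluated at $(q_0,m_0)$. Let $A(t)=\begin{bmatrix}\cos t&-\sin t\\ \sin t&\cos t\end{bmatrix}$ act diagonally on $\mathbb{R}^{2N}$ by $A(t)q=(A(t)q_1,\dots,A(t)q_N)$; thus, for $q_0=(x_{10},y_{10},\dots,x_{N0},y_{N0})^T$, $A'(0)q_0=(-y_{10},x_{10},\dots,-y_{N0},x_{N0})^T$. *)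

(* Defs.v *)
From mathcomp Require Import all_boot all_order all_algebra.
From mathcomp Require Import all_classical all_reals all_analysis.

Set Implicit Arguments.
Unset Strict Implicit.
Unset Printing Implicit Defensive.

Import Order.TTheory GRing.Theory Num.Theory.
Import numFieldNormedType.Exports.

Local Open Scope ring_scope.

(* A configuration q = (x_1, y_1, ..., x_N, y_N)^T is a column vector of
   size 2 * N.  Bodies and coordinates are numbered from 0, and coordinate k
   of body i sits at index 2 * i + k. *)

Lemma coord_subproof N (i : 'I_N) (k : 'I_2) : (2 * i + k < 2 * N)%N.
Proof.
apply: (@leq_trans (2 * i.+1)); last by rewrite leq_mul2l ltn_ord.
by rewrite mulnS addnC ltn_add2r ltn_ord.
Qed.

Definition coord N (i : 'I_N) (k : 'I_2) : 'I_(2 * N) :=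
  Ordinal (coord_subproof i k).

Lemma body_of_subproof N (l : 'I_(2 * N)) : (l %/ 2 < N)%N.
Proof. by rewrite ltn_divLR // [leqRHS]mulnC ltn_ord. Qed.

Definition body_of N (l : 'I_(2 * N)) : 'I_N := Ordinal (body_of_subproof l).

Definition axis_of N (l : 'I_(2 * N)) : 'I_2 :=
  Ordinal (ltn_pmod l (isT : (0 < 2)%N)).

Definition pos (R : realType) N (q : 'cV[R]_(2 * N)) (i : 'I_N) : 'cV[R]_2 :=
  \col_k q (coord i k) 0.

Definition stack (R : realType) N (f : 'I_N -> 'cV[R]_2) : 'cV[R]_(2 * N) :=
  \col_l f (body_of l) (axis_of l) 0.

Lemma stackK (R : realType) N (f : 'I_N -> 'cV[R]_2) : pos (stack f) =1 f.
Proof.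
move=> i; apply/colP => k; rewrite !mxE.
have -> : body_of (coord i k) = i.
  apply/val_inj; rewrite /= mulnC divnMDl // divn_small ?ltn_ord //.
  by rewrite addn0.
suff -> : axis_of (coord i k) = k by [].
by apply/val_inj; rewrite /= mulnC modnMDl modn_small ?ltn_ord.
Qed.

Lemma posK (R : realType) N (q : 'cV[R]_(2 * N)) : stack (pos q) = q.
Proof.
apply/colP => l; rewrite !mxE; congr (q _ _); apply/val_inj => /=.
by rewrite mulnC -divn_eq.
Qed.

(* The library norm on matrices is the sup norm. *)
Definition enorm (R : realType) (v : 'cV[R]_2) : R :=
  Num.sqrt (\sum_k v k 0 ^+ 2).

Definition collision_free (R : realType) N (q : 'cV[R]_(2 * N)) : Prop :=
  forall i j : 'I_N, i != j -> pos q i <> pos q j.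

Definition F (R : realType) N (lambda : R) (q : 'cV[R]_(2 * N))
    (m : 'I_N -> R) : 'cV[R]_(2 * N) :=
  stack (fun i =>
    \sum_(j < N | j != i)
      ((m i * m j) / enorm (pos q i - pos q j) ^+ 3) *: (pos q j - pos q i)
    + (lambda * m i) *: pos q i).

(* Entry (a, b) is the partial derivative of the a-th component with respect
   to the b-th variable.  The library's 'J acts on row vectors from the right,
   so this is its transpose: see Jac_jacobian. *)
Definition Jac (R : realType) n (G : 'cV[R]_n -> 'cV[R]_n) (q : 'cV[R]_n) :
    'M[R]_n :=
  \matrix_(a, b) 'D_(delta_mx b 0) (fun x => G x a 0) q.

Lemma Jac_jacobian (R : realType) n (G : 'cV[R]_n -> 'cV[R]_n) (q : 'cV[R]_n) :
  let Gr := fun v : 'rV[R]_n => (G v^T)^T in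
  differentiable Gr q^T -> Jac G q = ('J Gr q^T)^T.
Proof.
move=> Gr dG; apply/matrixP => a b; rewrite !mxE.
have dGb : derivable Gr q^T (delta_mx 0 b) by exact: diff_derivable dG.
have := deriveEjacobian (delta_mx 0 b) dG.
rewrite (derive_mx dGb) -rowE => /rowP/(_ a); rewrite !mxE => <-.
rewrite /derive.
set f1 := (X in lim (X @ _)%classic = _); set f2 := (X in _ = lim (X @ _)%classic).
suff -> : f1 = f2 by [].
apply/funext => h; rewrite /f1 /f2 /=.
have tE : (h *: delta_mx 0 b + q^T)^T = h *: delta_mx b 0 + q.
  by apply/colP => k; rewrite !mxE andbC.
by rewrite /Gr tE trmxK !mxE.
Qed.

Definition A (R : realType) (t : R) : 'M[R]_2 :=
  \matrix_(i, j)
    if i == j then cos t else if i == 0 then - sin t else sin t.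

Definition diag_act (R : realType) N (M : 'M[R]_2) (q : 'cV[R]_(2 * N)) :
    'cV[R]_(2 * N) :=
  stack (fun i => M *m pos q i).

Definition A'0 (R : realType) : 'M[R]_2 := derive1 (@A R) 0.

Lemma A'0E (R : realType) :
  A'0 R = \matrix_(i, j) if i == j then 0 else if i == 0 then - 1 else 1.
Proof.
have dA (i j : 'I_2) : is_derive (0 : R) 1 (fun t => A t i j)
    (if i == j then 0 else if i == 0 then - 1 else 1).
  under eq_fun do rewrite mxE.
  have dc : is_derive (0 : R) 1 (@cos R) 0.
    by have := is_derive_cos (0 : R); rewrite sin0 oppr0.
  have ds : is_derive (0 : R) 1 (@sin R) 1.
    by have := is_derive_sin (0 : R); rewrite cos0.
  by case: (i == j); [|case: (i == 0); [exact: is_deriveN|]].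
rewrite /A'0 derive1E derive_mx; last first.
  by apply/derivable_mxP => i j; have [] := dA i j.
by apply/matrixP => i j; rewrite !mxE; have [_ ->] := dA i j.
Qed.

Lemma pos_diag_act_A'0 (R : realType) N (q : 'cV[R]_(2 * N)) (i : 'I_N) :
  (pos (diag_act (A'0 R) q) i 0 0 = - pos q i 1 0) *
  (pos (diag_act (A'0 R) q) i 1 0 = pos q i 0 0).
Proof.
rewrite /diag_act stackK A'0E !mxE !big_ord_recl !big_ord0 /= !mxE /=.
rewrite !mul0r !mul1r mulN1r !addr0 add0r.
by split; do ?congr (- _); congr (q _ _); apply/val_inj.
Qed.

Lemma dim_split N : (2 <= N)%N -> (2 * N = 1 + (2 * N - 1))%N.
Proof. by move=> hN; rewrite subnKC // muln_gt0 (leq_trans _ hN). Qed.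

(* Main.v *)
(** [F] commutes with the diagonal action of rotations, so the circle of
    configurations [A t q0] consists of zeros of [F].  Differentiating
    [F (A t q0) = 0] at [t = 0] puts [A'(0) q0], the first column of [P], in the
    kernel of the Jacobian. *)

Require Import Defs.
From mathcomp Require Import all_boot all_order all_algebra.
From mathcomp Require Import all_classical all_reals all_analysis.
From mathcomp Require Import ring.

Set Implicit Arguments.
Unset Strict Implicit.
Unset Printing Implicit Defensive.

Import Order.TTheory GRing.Theory Num.Theory.
Import numFieldNormedType.Exports.

Local Open Scope ring_scope.

Section Rotation.
Variable R : realType.

Lemma A0 : A (0 : R) = 1%:M.
Proof.
by apply/matrixP => i j; rewrite !mxE cos0 sin0 oppr0 if_same; case: eqP.
Qed.

Lemma enorm_A (t : R) (v : 'cV[R]_2) : enorm (A t *m v) = enorm v.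
Proof.
rewrite /enorm; congr Num.sqrt.
rewrite !big_ord_recl !big_ord0 !mxE !big_ord_recl !big_ord0 !mxE /= !addr0.
(* The factor 1, rewritten as cos² + sin², makes both sides polynomials in the same quantities; the
   cross terms on the left cancel. *)
rewrite -[RHS]mul1r -(cos2Dsin2 t); ring.
Qed.

Lemma pos_diag_act N (M : 'M[R]_2) (q : 'cV[R]_(2 * N)) i :
  pos (diag_act M q) i = M *m pos q i.
Proof. exact: stackK. Qed.

Lemma diag_act1 N (q : 'cV[R]_(2 * N)) : diag_act 1%:M q = q.
Proof.
rewrite -[RHS]posK; congr (stack _).
by apply/funext => i; rewrite mul1mx.
Qed.

Lemma diag_act0 N (M : 'M[R]_2) : diag_act M (0 : 'cV[R]_(2 * N)) = 0.
Proof.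
apply/colP => l; rewrite !mxE big1 // => k _.
by rewrite !mxE mulr0.
Qed.

(** The interaction coefficients depend only on mutual distances, which rotations preserve
    ([enorm_A]), and they multiply position differences, on which [A t] acts linearly. *)
Lemma F_rotation N (lambda : R) (m : 'I_N -> R) t (q : 'cV[R]_(2 * N)) :
  F lambda (diag_act (A t) q) m = diag_act (A t) (F lambda q m).
Proof.
rewrite /F {2}/diag_act; congr (stack _); apply/funext => i.
rewrite stackK mulmxDr mulmx_sumr !pos_diag_act -scalemxAr; congr (_ + _).
apply: eq_bigr => j _.
by rewrite !pos_diag_act -!mulmxBr enorm_A scalemxAr.
Qed.

Lemma derivable_A : derivable (@A R) 0 1.
Proof.
apply/derivable_mxP => i j; under eq_fun do rewrite mxE.
have dsin : derivable (@sin R) 0 1 by exact: ex_derive.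
case: (i == j); first exact: ex_derive.
by case: (i == 0); first exact: derivableN.
Qed.

Lemma is_derive_A (i j : 'I_2) :
  is_derive (0 : R) 1 (fun t => A t i j) (A'0 R i j).
Proof.
rewrite /A'0 derive1E (derive_mx derivable_A) mxE; apply: derivableP.
by move/derivable_mxP : derivable_A; exact.
Qed.

Lemma is_derive_diag_act_A N (q : 'cV[R]_(2 * N)) :
  is_derive (0 : R) 1 (fun t => diag_act (A t) q) (diag_act (A'0 R) q).
Proof.
have dc l : is_derive (0 : R) 1 (fun t => diag_act (A t) q l 0)
    (diag_act (A'0 R) q l 0).
  rewrite /diag_act /stack mxE mxE !big_ord_recl big_ord0 addr0.
  under eq_fun do rewrite mxE mxE !big_ord_recl big_ord0 addr0.
  (* With [q] fixed, a coordinate of [diag_act (A t) q] is a sum of two entries of [A t], each times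
     a constant. *)
  have dM j (c : R) : is_derive (0 : R) 1 (fun t => A t (axis_of l) j * c)
      (A'0 R (axis_of l) j * c).
    have dA := is_derive_A (axis_of l) j.
    under eq_fun do rewrite mulrC.
    by rewrite mulrC; exact: is_deriveZ.
  exact: is_deriveD.
have dg : derivable (fun t => diag_act (A t) q) (0 : R) 1.
  by apply/derivable_mxP => l j; rewrite ord1; have [] := dc l.
apply: DeriveDef => //; rewrite derive_mx //.
by apply/colP => l; rewrite mxE; have [_ ->] := dc l.
Qed.

End Rotation.

Section Jacobian.
Variable R : realType.

Lemma sqr_sum_gt0 (v : 'cV[R]_2) : v != 0 -> 0 < \sum_k v k 0 ^+ 2.
Proof.
move=> v0; rewrite lt_neqAle eq_sym sumr_ge0 ?andbT; last first.
  by move=> k _; exact: sqr_ge0.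
apply: contra v0; rewrite psumr_eq0; last by move=> k _; exact: sqr_ge0.
move=> /allP v0; apply/eqP/colP => k; rewrite mxE; apply/eqP.
by rewrite -sqrf_eq0; apply: v0; rewrite mem_index_enum.
Qed.

Lemma enorm_gt0 (v : 'cV[R]_2) : v != 0 -> 0 < enorm v.
Proof. by move=> v0; rewrite sqrtr_gt0 sqr_sum_gt0. Qed.

Lemma differentiable_bigsum (V W : normedModType R) n (f : 'I_n -> V -> W) x :
  (forall i, differentiable (f i) x) ->
  differentiable (fun y => \sum_i f i y) x.
Proof.
move=> df; rewrite (_ : (fun y => _) = \sum_i f i); last first.
  by apply/funext => y; rewrite fct_sumE.
exact: differentiable_sum.
Qed.

Lemma differentiable_pos N i k (q : 'cV[R]_(2 * N)) :
  differentiable (fun x : 'cV[R]_(2 * N) => pos x i k 0) q.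
Proof. by under eq_fun do rewrite mxE; exact: differentiable_coord. Qed.

Lemma differentiable_posB N i j k (q : 'cV[R]_(2 * N)) :
  differentiable (fun x : 'cV[R]_(2 * N) => (pos x i - pos x j) k 0) q.
Proof.
under eq_fun do rewrite mxE [X in _ + X]mxE.
by apply: differentiableB; exact: differentiable_pos.
Qed.

(** The square root is differentiable at positive arguments, and distinct positions make the sum of
    squares positive. *)
Lemma differentiable_dist N (q : 'cV[R]_(2 * N)) i j : pos q i <> pos q j ->
  differentiable (fun x : 'cV[R]_(2 * N) => enorm (pos x i - pos x j)) q.
Proof.
move=> ij; apply: (@differentiable_comp _ _ _ _
  (fun x : 'cV[R]_(2 * N) => \sum_k (pos x i - pos x j) k 0 ^+ 2) Num.sqrt).
  apply: differentiable_bigsum => k.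
  by apply: (@differentiableX _ _ _ 1); exact: differentiable_posB.
apply/derivable1_diffP; apply: ex_derive; apply: is_derive1_sqrt.
by apply: sqr_sum_gt0; rewrite subr_eq0; exact/eqP.
Qed.

Lemma differentiable_F N (lambda : R) (m : 'I_N -> R) (q : 'cV[R]_(2 * N)) a :
  collision_free q -> differentiable (fun x => F lambda x m a 0) q.
Proof.
move=> cf; rewrite /F /stack.
under eq_fun do rewrite mxE mxE summxE [X in _ + X]mxE.
apply: differentiableD; last first.
  by apply: differentiableZ; exact: differentiable_pos.
(* The sum now runs over all bodies, the excluded index contributing the constant 0. *)
under eq_fun do rewrite big_mkcond.
apply: differentiable_bigsum => j.
case: (boolP (j != body_of a)) => [ji|_]; last exact: differentiable_cst.
under eq_fun do rewrite mxE.
apply: differentiableM; last exact: differentiable_posB.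
have ij : pos q (body_of a) <> pos q j by apply: cf; rewrite eq_sym.
apply: differentiableZ; apply: differentiableV.
  (* The exponent is passed as its predecessor, so [2] stands for the cube. *)
  by apply: (@differentiableX _ _ _ 2); exact: differentiable_dist.
by rewrite expf_neq0 // gt_eqF // enorm_gt0 // subr_eq0; exact/eqP.
Qed.

(** Differentiability makes directional derivatives linear in the direction, so expanding [v] over
    the [delta_mx] basis recovers the partial derivatives stored in [Jac]. *)
Lemma Jac_mulmx n (G : 'cV[R]_n -> 'cV[R]_n) q v a :
  differentiable (fun x => G x a 0) q ->
  (Jac G q *m v) a 0 = 'd (fun x => G x a 0) q v.
Proof.
move=> dG; rewrite mxE {2}(matrix_sum_delta v) linear_sum /=.
apply: eq_bigr => b _; rewrite big_ord1 linearZ /= mxE deriveE //.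
exact: mulrC.
Qed.

Lemma Jac_F_rotation N (lambda : R) (m : 'I_N -> R) (q : 'cV[R]_(2 * N)) :
  collision_free q -> F lambda q m = 0 ->
  Jac (fun x => F lambda x m) q *m diag_act (A'0 R) q = 0.
Proof.
move=> cf Fq0; apply/colP => a; have dF := differentiable_F lambda m a cf.
rewrite Jac_mulmx // mxE.
pose c (t : R) := diag_act (A t) q.
have [dc Dc] : is_derive (0 : R) 1 c (diag_act (A'0 R) q).
  exact: is_derive_diag_act_A.
have c0 : c 0 = q by rewrite /c A0 diag_act1.
move/derivable1_diffP : dc => dc.
(* The vector becomes the velocity of [c] at 0 and the base point becomes [c 0], the shape needed to
   read the chain rule from right to left. *)
rewrite -Dc deriveE //; rewrite -c0 in dF *.
have /(congr1 (@^~ 1)) /= <- := diff_comp dc dF.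
(* Along the orbit [F] equals the rotated value of [F] at [q], which is 0, so the composite is
   constant. *)
rewrite [X in 'd X _](_ : _ = cst 0) ?diff_cst //.
by apply/funext => t; rewrite /= F_rotation Fq0 diag_act0 mxE.
Qed.

End Jacobian.

(** The first column of [P] is [v], so that of [J *m P] is [J *m v], which vanishes, and left
    multiplication by [invmx P] keeps it zero. Taking [n] as a variable lets [e] be eliminated by
    substitution, which removes every cast; this would fail with [2 * N] in its place. *)
Lemma castmx_conj_block (R : comUnitRingType) n p (e : n = (1 + p)%N)
    (J P : 'M[R]_n) (v : 'cV[R]_n) (B1 : 'M[R]_1) (B2 : 'cV[R]_p) :
  col_mx B1 B2 = castmx (e, erefl 1%N) v ->
  castmx (e, e) P = block_mx B1 0 B2 1%:M -> J *m v = 0 ->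
  exists (J1 : 'rV[R]_p) (J2 : 'M[R]_p),
    castmx (e, e) (invmx P *m J *m P) = block_mx 0 J1 0 J2.
Proof.
subst n; rewrite !castmx_id => <- Pblock Jv.
set X := invmx P *m J *m P.
have X0 : lsubmx X = 0.
  have -> : X = row_mx 0 (invmx P *m J *m col_mx 0 1%:M).
    by rewrite /X {2}Pblock block_mxEh mul_mx_row -mulmxA Jv mulmx0.
  by rewrite row_mxKl.
(* The remaining columns of [X] are cut after the first row. *)
exists (usubmx (rsubmx X)), (dsubmx (rsubmx X)).
by rewrite block_mxEh vsubmxK col_mx0 -X0 hsubmxK.
Qed.

Theorem proposition3p2 (R : realType) (N : nat) (hN : (2 <= N)%N)
    (lambda : R) (hlambda : 0 < lambda)
    (m0 : 'I_N -> R) (hm0 : forall i, 0 < m0 i)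
    (q0 : 'cV[R]_(2 * N)) (hq0 : collision_free q0)
    (hcc : F lambda q0 m0 = 0)
    (B1 : 'M[R]_1) (B2 : 'cV[R]_(2 * N - 1))
    (hB : col_mx B1 B2 = castmx (dim_split hN, erefl 1%N) (diag_act (A'0 R) q0))
    (P : 'M[R]_(2 * N))
    (hP : castmx (dim_split hN, dim_split hN) P = block_mx B1 0 B2 1%:M)
    (hPunit : P \in unitmx) :
  exists (J1 : 'rV[R]_(2 * N - 1)) (J2 : 'M[R]_(2 * N - 1)),
    castmx (dim_split hN, dim_split hN)
      (invmx P *m Jac (fun q => F lambda q m0) q0 *m P)
    = block_mx 0 J1 0 J2.
Proof. by apply: (castmx_conj_block hB hP); exact: Jac_F_rotation. Qed.
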